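(* Let $(r_k)_{k\in\mathbb{N}_0}$ be an increasing sequence of real numbers with $0 < r_k < 2^{k-10}$ for all $k\in\mathbb{N}_0$, and let $(w_k)_{k\in\mathbb{N}_0}$ be a sequence of positive numbers. If $$\sup_{k\in\mathbb{N}_0}\ \sum_{n=[\log_2 r_k]}^k \frac{1}{w_n^{2}} = \infty,$$ then there exists a sequence of complex numbers $(a_k)_{k\in\mathbb{N}_0}$ such that $$\sum_{k=0}^\infty |a_k|^2 w_k^2 < \infty$$ but there does not exist a function $f\in C(\mathbb{T})$ such that $|\hat{f}(2^k)|\ge |a_k|$ for all $k\in\mathbb{N}_0$ and $$\hat{f}(n) = 0\quad\text{for all integers } n\notin \bigcup_{k\ge 0} [2^k-r_k, 2^k+r_k].$$
   Context: $\mathbb{N}_0=\{0,1,2,\dots\}$. $\mathbb{T}$ is the unit circle, viewed as the interval $[-\frac12,\frac12]$ with endpoints identified, equipped with Lebesgue probability measure. $C(\mathbb{T})$ is the space of continuous complex-valued functions on $\mathbb{T}$. For an integrable $f$ on $\mathbb{T}$ and $n\in\mathbb{Z}$, the Fourier coefficients are $\hat f(n)=\int_{-1/2}^{1/2} f(t)e^{-2\pi i n t}\,dt$. $[x]$ denotes the greatest integer not exceeding $x$. Convention: $w_k=\infty$ for $k<0$, i.e. terms $1/w_n^2$ with $n<0$ are equal to $0$. *)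

(* Defs.v *)
From Stdlib Require Export Reals ZArith.
From Coquelicot Require Export Coquelicot.
Open Scope R_scope.

(* [e^{2 pi i x}]; Coquelicot has no complex exponential, so Euler's formula
   is used. *)
Definition cis (x : R) : C := (cos (2 * PI * x), sin (2 * PI * x)).

(* The circle is [-1/2, 1/2] with endpoints identified, i.e. R/Z; a continuous
   function on it is a continuous 1-periodic function on the line. *)
Definition continuous_on_circle (f : R -> C) : Prop :=
  (forall t : R, continuous (U := C_UniformSpace) f t) /\
  (forall t : R, f (t + 1) = f t).

(* [RInt] is Riemann's integral, which agrees with Lebesgue's for the
   continuous [f] considered here; outside integrable [f] the value is junk. *)
Definition fourier_coeff (f : R -> C) (n : Z) : C :=
  RInt (V := C_R_CompleteNormedModule)
    (fun t : R => (f t * cis (- (IZR n * t)))%C) (- (1 / 2)) (1 / 2).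

Definition log2 (x : R) : R := ln x / ln 2.

(* [1 / w_n^2] for an integer index, with the convention that [w_n] is infinite
   for [n < 0]. *)
Definition inv_sq_weight (w : nat -> R) (n : Z) : R :=
  if (n <? 0)%Z then 0 else / (w (Z.to_nat n)) ^ 2.

(* [F m + F (m + 1) + ... + F p], which is empty when [p < m]; the last index
   passed to [sum_n] is inclusive. *)
Definition sum_Z (F : Z -> R) (m p : Z) : R :=
  if (p <? m)%Z then 0
  else sum_n (fun i : nat => F (m + Z.of_nat i)%Z) (Z.to_nat (p - m)).

(* Main.v *)
Require Import Defs.
From Stdlib Require Import Lra Lia Psatz IndefiniteDescription.

(** Write [f^(n)] for [fourier_coeff f n].  The theorem rests on a Sidon-type
    inequality for windows: if [f] is continuous, bounded by [M], and its
    spectrum lies in the union of the intervals [2^l - r l, 2^l + r l], then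
    [|f^(2^p)| + ... + |f^(2^k)| <= 5 M] as soon as [r k < 2^(p+1)]
    ([window_sum_le]).  The integer part of [log2 (r k)], or 0 when that is
    negative, is such a [p].

    The window inequality comes from testing [f] against Riesz products
    [P(t) = prod_i (1 + Re (c_i cis (- d 4^i t)))], where [d] is a power of 2
    larger than [r k] and [|c_i| <= 1].  All frequencies of [P] are multiples
    of [d].  A multiple of [d] below [(4/3) 2^k] in absolute value that lies in
    one of the intervals must be the centre [2^l] of its interval: for
    [2^l < d] the interval lies strictly between 0 and [d], for
    [d <= 2^l <= 2^k] its radius is less than [d], and for larger [l] it starts
    too far away ([dyadic_spectrum_of_gaps]).  Hence the
    only frequencies seen by [P] are powers of 2, and since the frequencies of
    [P] are lacunary of ratio 4, the only ones on which [P] charges the spectrum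
    of [f] are the [d 4^i] themselves: the integral of [f P] is exactly
    [sum_i c_i f^(d 4^i) / 2].  As [P >= 0] has integral 1, this is at most [M],
    and taking for [c_i] the phase that makes [c_i f^(d 4^i)] nonnegative gives
    [sum_i |f^(d 4^i)| <= 2 M] ([sidon_inequality_pow4]).  The products for [d]
    and for [2 d] together cover all the powers of 2 in the window beyond
    [2^p], and the coefficient at [2^p] is trivially at most [M].

    It remains to find [a >= 0] with [sum a_n^2 w_n^2] finite whose sums over
    the windows are unbounded.  With [v n = 1 / w_n^2], choose windows [W_j] on
    which the sum [S_j] of [v] exceeds [8^j].  The sequence [(2^j / S_j) v]
    restricted to [W_j] has window sum [2^j] and squared weighted norm
    [4^j / S_j < 2^-j], so that the square root of the sum over [j] of the
    squares of these sequences is as desired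
    ([exists_sequence_unbounded_on_windows]). *)

(** * Complex exponentials and continuous complex functions *)

Lemma cis_plus (x y : R) : cis (x + y) = (cis x * cis y)%C.
Proof.
  unfold cis, Cmult; simpl.
  rewrite Rmult_plus_distr_l, cos_plus, sin_plus.
  f_equal; ring.
Qed.

Lemma cis_0 : cis 0 = 1.
Proof. unfold cis; now rewrite Rmult_0_r, cos_0, sin_0. Qed.

Lemma Cmod_cis (x : R) : Cmod (cis x) = 1.
Proof.
  unfold Cmod, cis; simpl fst; simpl snd.
  rewrite <- sqrt_1; f_equal.
  generalize (sin2_cos2 (2 * PI * x)); unfold Rsqr; lra.
Qed.

Lemma cis_opp (x : R) : cis (- x) = Cconj (cis x).
Proof.
  unfold cis, Cconj; simpl.
  now rewrite <- Ropp_mult_distr_r, cos_neg, sin_neg.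
Qed.

Definition Ccontinuous (f : R -> C) : Prop :=
  forall t : R, continuous (U := C_UniformSpace) f t.

Lemma Ccontinuous_pair (a b : R -> R) :
  (forall t, continuous a t) -> (forall t, continuous b t) ->
  Ccontinuous (fun t => (a t, b t)).
Proof.
  intros Ha Hb t.
  apply (continuous_comp_2 (U := R_UniformSpace) (V := R_UniformSpace)
    (W := R_UniformSpace) (X := C_UniformSpace) a b (fun x y => (x, y))); auto.
  apply continuous_ext with (fun z : R * R => z); [now intros [x y]|].
  apply continuous_id.
Qed.

Lemma Ccontinuous_fst (f : R -> C) (t : R) :
  Ccontinuous f -> continuous (fun t => fst (f t)) t.
Proof.
  intros Hf.
  apply (continuous_comp (V := C_UniformSpace) f fst); [apply Hf|].
  destruct (f t); apply continuous_fst.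
Qed.

Lemma Ccontinuous_snd (f : R -> C) (t : R) :
  Ccontinuous f -> continuous (fun t => snd (f t)) t.
Proof.
  intros Hf.
  apply (continuous_comp (V := C_UniformSpace) f snd); [apply Hf|].
  destruct (f t); apply continuous_snd.
Qed.

Lemma Ccontinuous_plus (f g : R -> C) :
  Ccontinuous f -> Ccontinuous g -> Ccontinuous (fun t => (f t + g t)%C).
Proof.
  intros Hf Hg; unfold Cplus; apply Ccontinuous_pair; intros t;
    apply (continuous_plus (V := R_NormedModule));
    auto using Ccontinuous_fst, Ccontinuous_snd.
Qed.

Lemma Ccontinuous_mult (f g : R -> C) :
  Ccontinuous f -> Ccontinuous g -> Ccontinuous (fun t => (f t * g t)%C).
Proof.
  intros Hf Hg; unfold Cmult; apply Ccontinuous_pair; intros t.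
  - apply (continuous_minus (V := R_NormedModule));
      apply (continuous_mult (K := R_AbsRing));
      auto using Ccontinuous_fst, Ccontinuous_snd.
  - apply (continuous_plus (V := R_NormedModule));
      apply (continuous_mult (K := R_AbsRing));
      auto using Ccontinuous_fst, Ccontinuous_snd.
Qed.

Lemma Ccontinuous_const (c : C) : Ccontinuous (fun _ => c).
Proof. intros t; apply continuous_const. Qed.

Lemma Ccontinuous_cis (a : R) : Ccontinuous (fun t => cis (a * t)).
Proof.
  unfold cis; apply Ccontinuous_pair; intros t;
    apply (ex_derive_continuous (V := R_NormedModule)); now auto_derive.
Qed.

Lemma Ccontinuous_ex_RInt (f : R -> C) (a b : R) :
  Ccontinuous f -> ex_RInt (V := C_R_NormedModule) f a b.
Proof.
  intros Hf; apply (ex_RInt_continuous (V := C_R_CompleteNormedModule)).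
  intros z _; apply Hf.
Qed.

(** * Fourier coefficients *)

Definition fourier_integrand (f : R -> C) (n : Z) (t : R) : C :=
  (f t * cis (- (IZR n * t)))%C.

Lemma Ccontinuous_integrand (f : R -> C) (n : Z) :
  Ccontinuous f -> Ccontinuous (fourier_integrand f n).
Proof.
  intros Hf; unfold fourier_integrand; apply Ccontinuous_mult; auto.
  intros t; apply continuous_ext with (fun t => cis (- IZR n * t)).
  - intros x; f_equal; ring.
  - apply Ccontinuous_cis.
Qed.

Lemma is_fourier_coeff (f : R -> C) (n : Z) :
  Ccontinuous f ->
  is_RInt (V := C_R_NormedModule) (fourier_integrand f n)
    (- (1 / 2)) (1 / 2) (fourier_coeff f n).
Proof.
  intros Hf.
  apply (RInt_correct (V := C_R_CompleteNormedModule)).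
  now apply Ccontinuous_ex_RInt, Ccontinuous_integrand.
Qed.

Lemma fourier_coeff_unique (f : R -> C) (n : Z) (l : C) :
  is_RInt (V := C_R_NormedModule) (fourier_integrand f n)
    (- (1 / 2)) (1 / 2) l -> fourier_coeff f n = l.
Proof. apply (is_RInt_unique (V := C_R_CompleteNormedModule)). Qed.

Lemma fourier_coeff_plus (f g : R -> C) (n : Z) :
  Ccontinuous f -> Ccontinuous g ->
  fourier_coeff (fun t => (f t + g t)%C) n
  = (fourier_coeff f n + fourier_coeff g n)%C.
Proof.
  intros Hf Hg; apply fourier_coeff_unique.
  apply is_RInt_ext with
    (fun t => plus (G := C_R_NormedModule) (fourier_integrand f n t)
                (fourier_integrand g n t)).
  - intros t _; unfold fourier_integrand; symmetry; apply Cmult_plus_distr_r.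
  - now apply (is_RInt_plus (V := C_R_NormedModule)); apply is_fourier_coeff.
Qed.

(** The module structure of [C] used for integration has real scalars, so
    complex homogeneity of the integral is checked on real and imaginary
    parts. *)
Lemma is_RInt_Cmult_l (c : C) (f : R -> C) (a b : R) (l : C) :
  is_RInt (V := C_R_NormedModule) f a b l ->
  is_RInt (V := C_R_NormedModule) (fun t => (c * f t)%C) a b (c * l)%C.
Proof.
  intros Hf.
  assert (H1 := is_RInt_fct_extend_fst _ _ _ _ Hf).
  assert (H2 := is_RInt_fct_extend_snd _ _ _ _ Hf).
  apply is_RInt_fct_extend_pair; simpl.
  - apply (is_RInt_minus (V := R_NormedModule));
      now apply (is_RInt_scal (V := R_NormedModule)).
  - apply (is_RInt_plus (V := R_NormedModule));
      now apply (is_RInt_scal (V := R_NormedModule)).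
Qed.

Lemma fourier_coeff_scal (c : C) (f : R -> C) (n : Z) :
  Ccontinuous f ->
  fourier_coeff (fun t => (c * f t)%C) n = (c * fourier_coeff f n)%C.
Proof.
  intros Hf; apply fourier_coeff_unique.
  apply is_RInt_ext with (fun t => (c * fourier_integrand f n t)%C).
  - intros t _; apply Cmult_assoc.
  - now apply is_RInt_Cmult_l, is_fourier_coeff.
Qed.

Lemma fourier_coeff_ext (f g : R -> C) (n : Z) :
  (forall t, f t = g t) -> fourier_coeff f n = fourier_coeff g n.
Proof.
  intros Hfg; unfold fourier_coeff.
  apply (RInt_ext (V := C_R_CompleteNormedModule)).
  intros t _; now rewrite Hfg.
Qed.

Lemma fourier_coeff_shift (f : R -> C) (k n : Z) :
  fourier_coeff (fun t => (f t * cis (IZR k * t))%C) n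
  = fourier_coeff f (n - k).
Proof.
  unfold fourier_coeff.
  apply (RInt_ext (V := C_R_CompleteNormedModule)).
  intros t _; rewrite <- Cmult_assoc, <- cis_plus.
  do 2 f_equal; rewrite minus_IZR; ring.
Qed.

Lemma sin_PI_IZR (n : Z) : sin (PI * IZR n) = 0.
Proof. apply sin_eq_0_1; exists n; ring. Qed.

Lemma fourier_coeff_1 (n : Z) :
  fourier_coeff (fun _ => RtoC 1) n = if (n =? 0)%Z then RtoC 1 else RtoC 0.
Proof.
  apply fourier_coeff_unique; unfold fourier_integrand.
  destruct (Z.eqb_spec n 0) as [->|Hn].
  - apply is_RInt_ext with (fun _ => RtoC 1).
    + intros t _; rewrite Rmult_0_l, Ropp_0, cis_0; now rewrite Cmult_1_l.
    + evar_last.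
      * apply (is_RInt_const (V := C_R_NormedModule)).
      * apply injective_projections; simpl; unfold scal; simpl;
          unfold mult; simpl; lra.
  - apply is_RInt_ext with (fun t => cis (- (IZR n * t))).
    { intros t _; now rewrite Cmult_1_l. }
    assert (Hn' : IZR n <> 0) by now apply not_0_IZR.
    assert (HPI := PI_neq0).
    unfold cis; apply is_RInt_fct_extend_pair; simpl fst; simpl snd.
    + evar_last.
      * apply (is_RInt_derive (V := R_CompleteNormedModule)
          (fun t => - sin (2 * PI * - (IZR n * t)) / (2 * PI * IZR n))).
        -- intros x _; auto_derive; [easy|field; easy].
        -- intros x _; apply (ex_derive_continuous (V := R_NormedModule)).
           now auto_derive.
      * unfold minus, plus, opp; simpl.
        replace (2 * PI * - (IZR n * (1 / 2))) with (- (PI * IZR n)) by field.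
        replace (2 * PI * - (IZR n * - (1 / 2))) with (PI * IZR n) by field.
        rewrite sin_neg, sin_PI_IZR; field; easy.
    + evar_last.
      * apply (is_RInt_derive (V := R_CompleteNormedModule)
          (fun t => cos (2 * PI * - (IZR n * t)) / (2 * PI * IZR n))).
        -- intros x _; auto_derive; [easy|field; easy].
        -- intros x _; apply (ex_derive_continuous (V := R_NormedModule)).
           now auto_derive.
      * unfold minus, plus, opp; simpl.
        replace (2 * PI * - (IZR n * (1 / 2))) with (- (PI * IZR n)) by field.
        replace (2 * PI * - (IZR n * - (1 / 2))) with (PI * IZR n) by field.
        rewrite cos_neg; field; easy.
Qed.

Lemma norm_C_R (z : C) : norm (V := C_R_NormedModule) z = Cmod z.
Proof.
  unfold norm, Cmod; simpl; unfold prod_norm, norm; simpl; unfold abs; simpl.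
  f_equal; rewrite !Rmult_1_r, <- !Rabs_mult, !Rabs_pos_eq; auto;
    apply Rle_0_sqr.
Qed.

(** A nonnegative function [P] acts on [f] as a measure whose total mass is
    its zeroth coefficient. *)
Lemma Cmod_fourier_coeff_le (f : R -> C) (P : R -> R) (M : R) (n : Z) :
  Ccontinuous f -> Ccontinuous (fun t => RtoC (P t)) ->
  (forall t, - (1 / 2) <= t <= 1 / 2 -> Cmod (f t) <= M) ->
  (forall t, 0 <= P t) ->
  Cmod (fourier_coeff (fun t => (f t * P t)%C) n)
  <= M * Re (fourier_coeff (fun t => RtoC (P t)) 0).
Proof.
  intros Hf HP Hb Hpos.
  assert (HI := is_RInt_fct_extend_fst _ _ _ _
                  (is_fourier_coeff _ 0 HP)).
  rewrite <- norm_C_R.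
  apply (norm_RInt_le (V := C_R_NormedModule)
    (fourier_integrand (fun t => (f t * P t)%C) n)
    (fun t => M * fst (fourier_integrand (fun t => RtoC (P t)) 0 t))
    (- (1 / 2)) (1 / 2)).
  - lra.
  - intros t Ht; rewrite norm_C_R.
    change (Cmod (f t * P t * cis (- (IZR n * t)))
      <= M * fst (P t * cis (- (0 * t)))%C).
    rewrite !Cmod_mult, Cmod_cis, Cmod_R, Rabs_pos_eq by auto.
    rewrite Rmult_0_l, Ropp_0, cis_0; simpl.
    specialize (Hb t Ht); specialize (Hpos t); nra.
  - apply is_fourier_coeff; now apply Ccontinuous_mult.
  - apply (is_RInt_scal (V := R_NormedModule)); exact HI.
Qed.

Lemma Ccontinuous_bounded (f : R -> C) (a b : R) :
  a <= b -> Ccontinuous f ->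
  exists M, forall t, a <= t <= b -> Cmod (f t) <= M.
Proof.
  intros Hab Hf.
  destruct (continuity_ab_maj (fun t => Cmod (f t)) a b Hab) as [c [Hc _]].
  - intros t _; apply continuity_pt_filterlim.
    apply (filterlim_ext (fun t => norm (V := C_R_NormedModule) (f t))).
    { intros x; apply norm_C_R. }
    rewrite <- norm_C_R.
    eapply filterlim_comp; [apply (Hf t)|].
    apply (filterlim_norm (V := C_R_NormedModule)).
  - now exists (Cmod (f c)).
Qed.

(** * Riesz products *)

(** The minus sign makes [c], and not its conjugate, multiply the coefficient
    of frequency [N] when this factor is integrated against a function. *)
Definition riesz_factor (c : C) (N : Z) (t : R) : R :=
  1 + Re (c * cis (- (IZR N * t))).

Lemma riesz_factor_expand (c : C) (N : Z) (t : R) :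
  RtoC (riesz_factor c N t)
  = (1 + (c / 2 * cis (IZR (- N) * t) + Cconj c / 2 * cis (IZR N * t)))%C.
Proof.
  unfold riesz_factor; rewrite RtoC_plus, re_alt, Cmult_conj, <- cis_opp.
  rewrite Ropp_involutive, opp_IZR, Ropp_mult_distr_l; field.
Qed.

Lemma riesz_factor_ge_0 (c : C) (N : Z) (t : R) :
  Cmod c <= 1 -> 0 <= riesz_factor c N t.
Proof.
  intros Hc; unfold riesz_factor.
  assert (H := re_le_Cmod (c * cis (- (IZR N * t)))).
  rewrite Cmod_mult, Cmod_cis, Rmult_1_r in H.
  apply Rabs_le_between in H; lra.
Qed.

Lemma Ccontinuous_riesz_factor (c : C) (N : Z) :
  Ccontinuous (fun t => RtoC (riesz_factor c N t)).
Proof.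
  intros t; eapply continuous_ext.
  - intros x; symmetry; apply riesz_factor_expand.
  - revert t; change (Ccontinuous
      (fun t => (1 + (c / 2 * cis (IZR (- N) * t)
                      + Cconj c / 2 * cis (IZR N * t)))%C)).
    auto using Ccontinuous_plus, Ccontinuous_mult, Ccontinuous_const,
      Ccontinuous_cis.
Qed.

Lemma fourier_coeff_riesz_factor (f : R -> C) (c : C) (N m : Z) :
  Ccontinuous f ->
  fourier_coeff (fun t => (f t * riesz_factor c N t)%C) m
  = (fourier_coeff f m
     + (c / 2 * fourier_coeff f (m + N)
        + Cconj c / 2 * fourier_coeff f (m - N)))%C.
Proof.
  intros Hf.
  assert (Hs : forall k, Ccontinuous (fun t => (f t * cis (IZR k * t))%C)).
  { auto using Ccontinuous_mult, Ccontinuous_cis. }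
  rewrite (fourier_coeff_ext _ (fun t => (f t
    + (c / 2 * (f t * cis (IZR (- N) * t))
       + Cconj c / 2 * (f t * cis (IZR N * t))))%C)).
  2: { intros t; rewrite riesz_factor_expand; ring. }
  rewrite !fourier_coeff_plus, !fourier_coeff_scal, !fourier_coeff_shift;
    auto using Ccontinuous_plus, Ccontinuous_mult, Ccontinuous_const.
  do 4 f_equal; ring.
Qed.

Fixpoint riesz_product (d : Z) (c : nat -> C) (j : nat) (t : R) : R :=
  match j with
  | O => 1
  | S i => riesz_product d c i t * riesz_factor (c i) (d * 4 ^ Z.of_nat i) t
  end.

Lemma riesz_product_ge_0 (d : Z) (c : nat -> C) (j : nat) (t : R) :
  (forall i, Cmod (c i) <= 1) -> 0 <= riesz_product d c j t.
Proof.
  intros Hc; induction j as [|j IH]; simpl; [lra|].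
  now apply Rmult_le_pos; [|apply riesz_factor_ge_0].
Qed.

Lemma Ccontinuous_riesz_product (d : Z) (c : nat -> C) (j : nat) :
  Ccontinuous (fun t => RtoC (riesz_product d c j t)).
Proof.
  induction j as [|j IH]; simpl.
  - apply Ccontinuous_const.
  - intros t; eapply continuous_ext.
    + intros x; symmetry; apply RtoC_mult.
    + revert t; apply (Ccontinuous_mult _ _ IH), Ccontinuous_riesz_factor.
Qed.

Lemma fourier_coeff_riesz_product_S (f : R -> C) (d : Z) (c : nat -> C)
  (j : nat) (m : Z) :
  Ccontinuous f ->
  let g := fun t => (f t * riesz_product d c j t)%C in
  fourier_coeff (fun t => (f t * riesz_product d c (S j) t)%C) m
  = (fourier_coeff g m
     + (c j / 2 * fourier_coeff g (m + d * 4 ^ Z.of_nat j)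
        + Cconj (c j) / 2 * fourier_coeff g (m - d * 4 ^ Z.of_nat j)))%C.
Proof.
  intros Hf g; rewrite <- fourier_coeff_riesz_factor.
  - apply fourier_coeff_ext; intros t; unfold g; simpl.
    rewrite RtoC_mult; ring.
  - now apply Ccontinuous_mult; [|apply Ccontinuous_riesz_product].
Qed.

Lemma fourier_coeff_riesz_product_0 (f : R -> C) (d : Z) (c : nat -> C)
  (m : Z) :
  fourier_coeff (fun t => (f t * riesz_product d c 0 t)%C) m
  = fourier_coeff f m.
Proof. apply fourier_coeff_ext; intros t; apply Cmult_1_r. Qed.

Lemma pow4_S (j : nat) : (4 ^ Z.of_nat (S j) = 4 * 4 ^ Z.of_nat j)%Z.
Proof. now rewrite Nat2Z.inj_succ, Z.pow_succ_r by lia. Qed.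

Lemma pow4_pos (j : nat) : (0 < 4 ^ Z.of_nat j)%Z.
Proof. apply Z.pow_pos_nonneg; lia. Qed.

(** The nonzero frequencies of a Riesz product are [d x] with [x <> 0] a signed
    sum of distinct [4^i], [i < j]; such an [x] satisfies
    [|x| <= 1 + 4 + ... + 4^(j-1) < 4^j / 3].  So when [f] has no coefficient at
    the other points [m + d x] in that range, the coefficient at [m] can only
    come from the constant term of the product.  The induction peels off the
    largest frequency [d 4^j]: its two side terms are coefficients at
    [m + d 4^j] and [m - d 4^j], and those of [f] vanish there and at all
    points that the shorter product can reach from there. *)
Lemma fourier_coeff_riesz_product_isolated (f : R -> C) (d : Z)
  (c : nat -> C) (j : nat) (m : Z) :
  Ccontinuous f ->
  (forall x : Z, x <> 0%Z -> (3 * Z.abs x < 4 ^ Z.of_nat j)%Z ->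
     fourier_coeff f (m + d * x) = RtoC 0) ->
  fourier_coeff (fun t => (f t * riesz_product d c j t)%C) m
  = fourier_coeff f m.
Proof.
  intros Hf; revert m; induction j as [|j IH]; intros m Hm.
  - apply fourier_coeff_riesz_product_0.
  - rewrite fourier_coeff_riesz_product_S; auto.
    rewrite pow4_S in Hm; assert (Hj := pow4_pos j).
    assert (Hside : forall s, (Z.abs s = 1)%Z ->
      fourier_coeff (fun t => (f t * riesz_product d c j t)%C)
        (m + d * (s * 4 ^ Z.of_nat j)) = RtoC 0).
    { intros s Hs; rewrite IH.
      - apply Hm; nia.
      - intros x _ Hx.
        rewrite <- Z.add_assoc, <- Z.mul_add_distr_l; apply Hm; nia. }
    rewrite (IH m) by (intros x Hx0 Hx; apply Hm; lia).
    replace (m + d * 4 ^ Z.of_nat j)%Z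
      with (m + d * (1 * 4 ^ Z.of_nat j))%Z by ring.
    replace (m - d * 4 ^ Z.of_nat j)%Z
      with (m + d * (- 1 * 4 ^ Z.of_nat j))%Z by ring.
    rewrite !Hside by easy; ring.
Qed.

Lemma riesz_product_mean (d : Z) (c : nat -> C) (j : nat) :
  d <> 0%Z ->
  fourier_coeff (fun t => RtoC (riesz_product d c j t)) 0 = RtoC 1.
Proof.
  intros Hd.
  rewrite (fourier_coeff_ext _ (fun t => (1 * riesz_product d c j t)%C))
    by (intros t; now rewrite Cmult_1_l).
  rewrite (fourier_coeff_riesz_product_isolated (fun _ => RtoC 1)).
  - now rewrite fourier_coeff_1.
  - apply Ccontinuous_const.
  - intros x Hx _; rewrite fourier_coeff_1.
    destruct (Z.eqb_spec (0 + d * x) 0); auto; nia.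
Qed.

(** Inversion being total, [phase 0 = 0] because of the factor [Cconj 0]; this
    keeps [phase z * z = Cmod z] true without a case distinction. *)
Definition phase (z : C) : C := (Cconj z * RtoC (/ Cmod z))%C.

Lemma Cmod_phase (z : C) : Cmod (phase z) <= 1.
Proof.
  unfold phase; rewrite Cmod_mult, Cmod_conj, Cmod_R.
  destruct (Req_dec (Cmod z) 0) as [->|Hz]; [lra|].
  assert (H := Cmod_ge_0 z).
  rewrite Rabs_pos_eq by (apply Rlt_le, Rinv_0_lt_compat; lra).
  rewrite Rinv_r by easy; lra.
Qed.

Lemma phase_mult (z : C) : (phase z * z)%C = RtoC (Cmod z).
Proof.
  unfold phase.
  replace (Cconj z * RtoC (/ Cmod z) * z)%C
    with (z * Cconj z * RtoC (/ Cmod z))%C by ring.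
  rewrite <- Cmod2_conj, <- RtoC_mult; f_equal.
  destruct (Req_dec (Cmod z) 0) as [->|Hz]; [ring|now field].
Qed.

(** * Sidon inequality for powers of 2 *)

Lemma pow2_between_pow4 (i l : Z) :
  (0 <= i)%Z -> (2 * 4 ^ i < 3 * 2 ^ l < 4 * 4 ^ i)%Z -> (2 ^ l = 4 ^ i)%Z.
Proof.
  intros Hi H.
  change 4%Z with (2 ^ 2)%Z in *; rewrite <- Z.pow_mul_r in * by lia.
  assert (Hp : (0 < 2 ^ (2 * i))%Z) by (apply Z.pow_pos_nonneg; lia).
  destruct (Z.lt_trichotomy l (2 * i)) as [Hl|[->|Hl]];
    [exfalso|easy|exfalso].
  - assert (2 ^ (l + 1) <= 2 ^ (2 * i))%Z by (apply Z.pow_le_mono_r; lia).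
    destruct (Z.lt_ge_cases l 0) as [Hl0|Hl0].
    + rewrite (Z.pow_neg_r 2 l) in H by lia; lia.
    + rewrite Z.pow_add_r in H0 by lia; lia.
  - assert (2 ^ (2 * i + 1) <= 2 ^ l)%Z by (apply Z.pow_le_mono_r; lia).
    rewrite Z.pow_add_r in H0 by lia; lia.
Qed.

(** The factor 3 matches the bound [4^j / 3] on the frequencies of a Riesz
    product with [j] factors.  In particular [f^(0) = 0] when [0 < B]. *)
Definition dyadic_spectrum (f : R -> C) (d B : Z) : Prop :=
  forall x : Z, (3 * Z.abs x < B)%Z ->
    (forall l : nat, x <> 2 ^ Z.of_nat l)%Z -> fourier_coeff f (d * x) = RtoC 0.

Lemma dyadic_spectrum_le (f : R -> C) (d B B' : Z) :
  (B' <= B)%Z -> dyadic_spectrum f d B -> dyadic_spectrum f d B'.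
Proof. intros HB H x Hx; apply H; lia. Qed.

(** Each new factor reads off one more coefficient.  The side term at
    [- d 4^j] only involves [f^(d x)] with [x < 0], which vanishes.
    In the side term at [d 4^j] the product only sees frequencies [d y] with
    [(2/3) 4^j < y < (4/3) 4^j], and [4^j] is the only power of 2 there. *)
Lemma riesz_product_mean_step (f : R -> C) (d : Z) (c : nat -> C) (j : nat) :
  Ccontinuous f -> dyadic_spectrum f d (4 ^ Z.of_nat (S j)) ->
  fourier_coeff (fun t => (f t * riesz_product d c (S j) t)%C) 0
  = (fourier_coeff (fun t => (f t * riesz_product d c j t)%C) 0
     + c j / 2 * fourier_coeff f (d * 4 ^ Z.of_nat j))%C.
Proof.
  intros Hf Hspec; unfold dyadic_spectrum in Hspec; rewrite pow4_S in Hspec.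
  assert (Hj := pow4_pos j).
  assert (Hneg : fourier_coeff f (0 - d * 4 ^ Z.of_nat j) = RtoC 0).
  { replace (0 - d * 4 ^ Z.of_nat j)%Z
      with (d * - 4 ^ Z.of_nat j)%Z by ring.
    apply Hspec; [lia|intros l Hl].
    assert (0 < 2 ^ Z.of_nat l)%Z by (apply Z.pow_pos_nonneg; lia); lia. }
  rewrite fourier_coeff_riesz_product_S; auto; simpl.
  rewrite (fourier_coeff_riesz_product_isolated _ _ _ _
             (0 + d * 4 ^ Z.of_nat j)); auto.
  2: { intros x Hx0 Hx; simpl (0 + _)%Z.
    rewrite <- Z.mul_add_distr_l; apply Hspec; [lia|intros l Hl].
    assert (2 ^ Z.of_nat l = 4 ^ Z.of_nat j)%Z
      by (apply pow2_between_pow4; lia); lia. }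
  rewrite (fourier_coeff_riesz_product_isolated _ _ _ _
             (0 - d * 4 ^ Z.of_nat j)); auto.
  2: { intros x Hx0 Hx.
    replace (0 - d * 4 ^ Z.of_nat j + d * x)%Z
      with (d * (x - 4 ^ Z.of_nat j))%Z by ring.
    apply Hspec; [lia|intros l Hl].
    assert (0 < 2 ^ Z.of_nat l)%Z by (apply Z.pow_pos_nonneg; lia); lia. }
  rewrite Hneg, Z.add_0_l; ring.
Qed.

Lemma riesz_product_mean_phases (f : R -> C) (d : Z) (j : nat) :
  Ccontinuous f -> dyadic_spectrum f d (4 ^ Z.of_nat (S j)) ->
  fourier_coeff (fun t => (f t * riesz_product d
    (fun i => phase (fourier_coeff f (d * 4 ^ Z.of_nat i))) (S j) t)%C) 0
  = RtoC (sum_n (fun i => Cmod (fourier_coeff f (d * 4 ^ Z.of_nat i))) j / 2).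
Proof.
  intros Hf.
  assert (Hread : forall i, (phase (fourier_coeff f (d * 4 ^ Z.of_nat i)) / 2
    * fourier_coeff f (d * 4 ^ Z.of_nat i)
    = RtoC (Cmod (fourier_coeff f (d * 4 ^ Z.of_nat i)) / 2))%C).
  { intros i; rewrite RtoC_div, <- phase_mult by lra; unfold Cdiv; ring. }
  induction j as [|j IH]; intros Hspec;
    rewrite riesz_product_mean_step, Hread; auto.
  - rewrite fourier_coeff_riesz_product_0, sum_O.
    replace (fourier_coeff f 0) with (RtoC 0); [apply Cplus_0_l|].
    symmetry; replace 0%Z with (d * 0)%Z at 1 by ring.
    apply Hspec; [easy|intros l Hl].
    assert (0 < 2 ^ Z.of_nat l)%Z by (apply Z.pow_pos_nonneg; lia); lia.
  - rewrite IH, sum_Sn, <- RtoC_plus.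
    + f_equal; unfold plus; simpl; lra.
    + revert Hspec; apply dyadic_spectrum_le.
      apply Z.pow_le_mono_r; lia.
Qed.

Lemma sidon_inequality_pow4 (f : R -> C) (M : R) (d : Z) (j : nat) :
  Ccontinuous f -> (forall t, - (1 / 2) <= t <= 1 / 2 -> Cmod (f t) <= M) ->
  d <> 0%Z -> dyadic_spectrum f d (4 ^ Z.of_nat (S j)) ->
  sum_n (fun i => Cmod (fourier_coeff f (d * 4 ^ Z.of_nat i))) j <= 2 * M.
Proof.
  intros Hf HM Hd Hspec.
  set (c := fun i => phase (fourier_coeff f (d * 4 ^ Z.of_nat i))).
  assert (H := Cmod_fourier_coeff_le f (riesz_product d c (S j)) M 0 Hf
    (Ccontinuous_riesz_product _ _ _) HM
    (fun t => riesz_product_ge_0 d c (S j) t (fun i => Cmod_phase _))).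
  unfold c in H at 1.
  rewrite riesz_product_mean_phases, riesz_product_mean in H; auto.
  rewrite Cmod_R in H; simpl in H.
  apply Rabs_le_between in H; lra.
Qed.

Lemma sum_n_even_odd (a : nat -> R) (j : nat) :
  sum_n a (2 * j + 1)
  = sum_n (fun i => a (2 * i)%nat) j + sum_n (fun i => a (2 * i + 1)%nat) j.
Proof.
  induction j as [|j IH].
  - change (2 * 0 + 1)%nat with 1%nat; rewrite sum_Sn, !sum_O; reflexivity.
  - replace (2 * S j + 1)%nat with (S (S (2 * j + 1))) by lia.
    rewrite !sum_Sn, IH.
    replace (S (S (2 * j + 1))) with (2 * S j + 1)%nat by lia.
    replace (S (2 * j + 1)) with (2 * S j)%nat by lia.
    unfold plus; simpl; ring.
Qed.

(** The even exponents are handled by the Riesz product for [d] and the odd ones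
    by the one for [2 d].  The two products together are sensitive to
    frequencies up to [(4/3) d 2^j], whence the bound [2^(j+2)]. *)
Lemma sidon_inequality_pow2 (f : R -> C) (M : R) (d : Z) (j : nat) :
  Ccontinuous f -> (forall t, - (1 / 2) <= t <= 1 / 2 -> Cmod (f t) <= M) ->
  d <> 0%Z -> dyadic_spectrum f d (2 ^ Z.of_nat (j + 2)) ->
  sum_n (fun i => Cmod (fourier_coeff f (d * 2 ^ Z.of_nat i))) j <= 4 * M.
Proof.
  intros Hf HM Hd Hspec.
  assert (Heven : forall i, (2 * i <= j)%nat ->
    sum_n (fun i => Cmod (fourier_coeff f (d * 2 ^ Z.of_nat (2 * i)))) i
    <= 2 * M).
  { intros i Hi.
    rewrite (sum_n_ext _
      (fun i => Cmod (fourier_coeff f (d * 4 ^ Z.of_nat i)))).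
    - apply sidon_inequality_pow4; auto; revert Hspec; apply dyadic_spectrum_le.
      change 4%Z with (2 ^ 2)%Z; rewrite <- Z.pow_mul_r by lia.
      apply Z.pow_le_mono_r; lia.
    - intros k; rewrite Nat2Z.inj_mul, Z.pow_mul_r by lia; reflexivity. }
  assert (Hodd : forall i, (2 * i + 1 <= j)%nat ->
    sum_n (fun i => Cmod (fourier_coeff f (d * 2 ^ Z.of_nat (2 * i + 1)))) i
    <= 2 * M).
  { intros i Hi.
    rewrite (sum_n_ext _
      (fun i => Cmod (fourier_coeff f (2 * d * 4 ^ Z.of_nat i)))).
    - apply sidon_inequality_pow4; auto; [lia|].
      intros x Hx Hpow.
      replace (2 * d * x)%Z with (d * (2 * x))%Z by ring; apply Hspec.
      + change 4%Z with (2 ^ 2)%Z in Hx; rewrite <- Z.pow_mul_r in Hx by lia.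
        assert (2 ^ (2 * Z.of_nat (S i)) <= 2 ^ Z.of_nat (j + 1))%Z
          by (apply Z.pow_le_mono_r; lia).
        replace (Z.of_nat (j + 2)) with (Z.succ (Z.of_nat (j + 1))) by lia.
        rewrite Z.pow_succ_r by lia; lia.
      + intros [|l] Hl; [change (2 * x = 1)%Z in Hl; lia|].
        rewrite Nat2Z.inj_succ, Z.pow_succ_r in Hl by lia.
        apply (Hpow l); lia.
    - intros k; rewrite Nat2Z.inj_add, Z.pow_add_r, Nat2Z.inj_mul,
        Z.pow_mul_r by lia.
      change (2 ^ Z.of_nat 2)%Z with 4%Z; change (2 ^ Z.of_nat 1)%Z with 2%Z.
      do 2 f_equal; ring. }
  destruct (Nat.Even_or_Odd j) as [[i ->]|[i ->]].
  - destruct i as [|i].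
    + assert (HM0 : 0 <= M).
      { apply Rle_trans with (Cmod (f 0)); [apply Cmod_ge_0|apply HM; lra]. }
      assert (H := Heven 0%nat (Nat.le_refl _)).
      change (2 * 0)%nat with 0%nat; rewrite sum_O in *; simpl in *; lra.
    + replace (2 * S i)%nat with (S (2 * i + 1)) at 1 by lia.
      rewrite sum_Sn, sum_n_even_odd.
      assert (H1 := Heven (S i)); assert (H2 := Hodd i).
      rewrite sum_Sn in H1.
      replace (S (2 * i + 1)) with (2 * S i)%nat by lia.
      specialize (H1 ltac:(lia)); specialize (H2 ltac:(lia)).
      unfold plus in *; simpl in *; lra.
  - rewrite sum_n_even_odd.
    specialize (Heven i ltac:(lia)); specialize (Hodd i ltac:(lia)); lra.
Qed.

(** * The window inequality *)

Lemma IZR_pow2 (n : nat) : IZR (2 ^ Z.of_nat n) = 2 ^ n.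
Proof. now rewrite pow_IZR. Qed.

(** A multiple of [2^n] in the interval around [2^l] is [2^l] itself when
    [n <= l <= n + j], because the radius is less than [2^n].  For [l < n] the
    interval lies strictly between 0 and [2^n], and for [l > n + j] it lies
    beyond [(4/3) 2^(n+j)], hence out of the range considered. *)
Lemma dyadic_spectrum_of_gaps (r : nat -> R) (f : R -> C) (n j : nat) :
  Un_growing r -> (forall l, r l <= 2 ^ l / 4) -> r (n + j)%nat < 2 ^ n ->
  (forall m : Z, ~ (exists l : nat, 2 ^ l - r l <= IZR m <= 2 ^ l + r l) ->
     fourier_coeff f m = RtoC 0) ->
  dyadic_spectrum f (2 ^ Z.of_nat n) (2 ^ Z.of_nat (j + 2)).
Proof.
  intros Hr Hr4 Hrn Hf x Hx Hpow; apply Hf; intros [l Hl].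
  rewrite mult_IZR, IZR_pow2 in Hl.
  assert (Hn : 0 < 2 ^ n) by (apply pow_lt; lra).
  specialize (Hr4 l).
  assert (Hl0 : 0 < 2 ^ l) by (apply pow_lt; lra).
  destruct (Nat.le_gt_cases l (n + j)) as [Hlk|Hlk].
  - assert (Hrl : r l < 2 ^ n).
    { apply Rle_lt_trans with (2 := Hrn).
      apply Rge_le, growing_prop; auto with zarith. }
    destruct (Nat.le_gt_cases n l) as [Hnl|Hnl].
    + destruct (Nat.le_exists_sub n l Hnl) as [e [-> _]].
      apply (Hpow e).
      rewrite pow_add, <- (IZR_pow2 e) in Hl.
      set (y := (2 ^ Z.of_nat e)%Z) in *.
      assert (IZR x < IZR (y + 1)) by (rewrite plus_IZR; nra).
      assert (IZR y < IZR (x + 1)) by (rewrite plus_IZR; nra).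
      apply lt_IZR in H, H0; lia.
    + assert (Hln : 2 * 2 ^ l <= 2 ^ n).
      { change (2 * 2 ^ l) with (2 ^ S l); apply Rle_pow; lra || lia. }
      assert (0 < IZR x) by nra.
      assert (IZR x < 1) by nra.
      apply lt_IZR in H, H0; lia.
  - assert (Hkl : 2 * (2 ^ n * 2 ^ j) <= 2 ^ l).
    { rewrite <- pow_add; change (2 * 2 ^ (n + j)) with (2 ^ S (n + j)).
      apply Rle_pow; lra || lia. }
    apply IZR_lt in Hx; rewrite mult_IZR, IZR_pow2, abs_IZR, pow_add in Hx.
    assert (Hx' := Rle_abs (IZR x)).
    assert (2 ^ n * (3 * IZR x) < 2 ^ n * (2 ^ j * 2 ^ 2))
      by (apply Rmult_lt_compat_l; lra).
    simpl in H; lra.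
Qed.

Lemma sum_n_m_shift (a : nat -> R) (p j : nat) :
  sum_n_m a p (p + j) = sum_n (fun i => a (p + i)%nat) j.
Proof.
  induction j as [|j IH].
  - now rewrite sum_O, Nat.add_0_r, sum_n_n.
  - rewrite Nat.add_succ_r, sum_n_Sm, sum_Sn, IH by lia.
    now rewrite Nat.add_succ_r.
Qed.

(** With [d = 2^(p+1) > r k] the Sidon inequality bounds the sum from [p + 1]
    to [k] by [4 M], and the term of index [p] is at most [M]. *)
Lemma window_sum_le (r : nat -> R) (f : R -> C) (M : R) (p k : nat) :
  Un_growing r -> (forall l, r l <= 2 ^ l / 4) ->
  (p <= k)%nat -> r k < 2 ^ S p ->
  Ccontinuous f -> (forall t, - (1 / 2) <= t <= 1 / 2 -> Cmod (f t) <= M) ->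
  (forall m : Z, ~ (exists l : nat, 2 ^ l - r l <= IZR m <= 2 ^ l + r l) ->
     fourier_coeff f m = RtoC 0) ->
  sum_n_m (fun n => Cmod (fourier_coeff f (2 ^ Z.of_nat n))) p k <= 5 * M.
Proof.
  intros Hr Hr4 Hpk Hrk Hf HM Hspec.
  assert (Hp : Cmod (fourier_coeff f (2 ^ Z.of_nat p)) <= M).
  { assert (H := Cmod_fourier_coeff_le f (fun _ => 1) M (2 ^ Z.of_nat p) Hf
      (Ccontinuous_const _) HM (fun _ => Rle_0_1)).
    rewrite fourier_coeff_1, Rmult_1_r in H; simpl in H.
    rewrite (fourier_coeff_ext _ f) in H; auto.
    intros t; apply Cmult_1_r. }
  destruct (Nat.eq_dec p k) as [->|Hne].
  - rewrite sum_n_n.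
    assert (H := Cmod_ge_0 (fourier_coeff f (2 ^ Z.of_nat k))); lra.
  - rewrite sum_Sn_m by easy.
    destruct (Nat.le_exists_sub (S p) k) as [j [-> _]]; [lia|].
    rewrite Nat.add_comm, sum_n_m_shift.
    rewrite (sum_n_ext _ (fun i =>
      Cmod (fourier_coeff f (2 ^ Z.of_nat (S p) * 2 ^ Z.of_nat i)))).
    2: { intros i; now rewrite Nat2Z.inj_add, Z.pow_add_r by lia. }
    assert (H : sum_n (fun i => Cmod (fourier_coeff f
        (2 ^ Z.of_nat (S p) * 2 ^ Z.of_nat i))) j <= 4 * M).
    { apply sidon_inequality_pow2; auto.
      - apply Z.pow_nonzero; lia.
      - apply dyadic_spectrum_of_gaps with r; auto.
        now rewrite Nat.add_comm. }
    change (@plus R_AbelianMonoid) with Rplus; lra.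
Qed.

(** * The windows of the theorem *)

(** Here truncating a negative [m] to 0 in [Z.to_nat m] agrees with the
    convention that the terms of negative index vanish. *)
Lemma sum_Z_inv_sq_weight (w : nat -> R) (m : Z) (k : nat) :
  (m <= Z.of_nat k)%Z ->
  sum_Z (inv_sq_weight w) m (Z.of_nat k)
  = sum_n_m (fun n => / (w n) ^ 2) (Z.to_nat m) k.
Proof.
  intros Hmk; unfold sum_Z.
  destruct (Z.ltb_spec (Z.of_nat k) m) as [?|_]; [lia|].
  assert (H : forall q : nat,
    sum_n (fun i => inv_sq_weight w (m + Z.of_nat i)) q
    = if (m + Z.of_nat q <? 0)%Z then 0
      else sum_n_m (fun n => / (w n) ^ 2) (Z.to_nat m)
             (Z.to_nat (m + Z.of_nat q))).
  { induction q as [|q IH].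
    - rewrite sum_O; unfold inv_sq_weight; rewrite Z.add_0_r.
      now rewrite sum_n_n.
    - rewrite sum_Sn, IH; unfold inv_sq_weight.
      destruct (Z.ltb_spec (m + Z.of_nat q) 0);
        destruct (Z.ltb_spec (m + Z.of_nat (S q)) 0); try lia.
      + apply Rplus_0_l.
      + replace (Z.to_nat m) with 0%nat by lia.
        replace (Z.to_nat (m + Z.of_nat (S q))) with 0%nat by lia.
        rewrite sum_n_n; apply Rplus_0_l.
      + replace (Z.to_nat (m + Z.of_nat (S q)))
          with (S (Z.to_nat (m + Z.of_nat q))) by lia.
        now rewrite sum_n_Sm by lia. }
  rewrite H.
  destruct (Z.ltb_spec (m + Z.of_nat (Z.to_nat (Z.of_nat k - m))) 0); [lia|].
  f_equal; lia.
Qed.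

Lemma exp_INR_ln2 (n : nat) : exp (INR n * ln 2) = 2 ^ n.
Proof. now rewrite <- Rpower_pow by lra. Qed.

(** Truncation at 0 only increases the exponent, so the bound also holds for
    [x < 1]. *)
Lemma lt_pow2_Zfloor_log2 (x : R) :
  0 < x -> x < 2 ^ S (Z.to_nat (Zfloor (log2 x))).
Proof.
  intros Hx.
  assert (Hln2 : 0 < ln 2) by (rewrite <- ln_1; apply ln_increasing; lra).
  rewrite <- exp_INR_ln2, <- (exp_ln x) at 1 by easy.
  apply exp_increasing.
  replace (ln x) with (log2 x * ln 2) by (unfold log2; field; lra).
  apply Rmult_lt_compat_r; auto.
  apply Rlt_le_trans with (IZR (Zfloor (log2 x)) + 1).
  - apply Zfloor_bound.
  - rewrite INR_IZR_INZ, <- plus_IZR; apply IZR_le; lia.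
Qed.

Lemma Zfloor_log2_le (x : R) (k : nat) :
  0 < x -> x <= 2 ^ k -> (Zfloor (log2 x) <= Z.of_nat k)%Z.
Proof.
  intros Hx Hxk.
  assert (Hln2 : 0 < ln 2) by (rewrite <- ln_1; apply ln_increasing; lra).
  rewrite <- (ZfloorZ (Z.of_nat k)); apply Zfloor_le.
  unfold log2; apply Rle_div_l; auto.
  rewrite <- INR_IZR_INZ, <- (ln_exp (INR k * ln 2)), exp_INR_ln2.
  now apply ln_le.
Qed.

(** * Square-summable sequences with unbounded window sums *)

Lemma sum_n_m_ge_0 (a : nat -> R) (n m : nat) :
  (forall i, 0 <= a i) -> 0 <= sum_n_m a n m.
Proof.
  intros Ha; apply Rle_trans with (sum_n_m (fun _ => 0) n m).
  - rewrite sum_n_m_const; lra.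
  - now apply sum_n_m_le.
Qed.

Lemma Series_ge_term (a : nat -> R) (j : nat) :
  (forall n, 0 <= a n) -> ex_series a -> a j <= Series a.
Proof.
  intros Ha Hex.
  assert (H := is_lim_seq_incr_compare (sum_n a) (Series a)
    (Series_correct _ Hex)).
  apply Rle_trans with (sum_n a j).
  - destruct j as [|j]; [now rewrite sum_O; apply Rle_refl|].
    rewrite sum_Sn.
    assert (0 <= sum_n a j) by now apply sum_n_m_ge_0.
    unfold plus; simpl; lra.
  - apply H; intros n; rewrite sum_Sn; specialize (Ha (S n)).
    unfold plus; simpl; lra.
Qed.

Lemma ex_series_bounded (a : nat -> R) (M : R) :
  (forall n, 0 <= a n) -> (forall N, sum_n a N <= M) -> ex_series a.
Proof.
  intros Ha HM.
  destruct (ex_finite_lim_seq_incr (sum_n a) M) as [l Hl]; auto.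
  - intros n; rewrite sum_Sn; specialize (Ha (S n)).
    unfold plus; simpl; lra.
  - now exists l.
Qed.

Lemma is_series_sum_n (t : nat -> nat -> R) (s : nat -> R) (N : nat) :
  (forall n, is_series (fun j => t j n) (s n)) ->
  is_series (fun j => sum_n (t j) N) (sum_n s N).
Proof.
  intros Ht; induction N as [|N IH].
  - rewrite sum_O; apply is_series_ext with (fun j => t j 0%nat); auto.
    intros j; now rewrite sum_O.
  - rewrite sum_Sn.
    apply is_series_ext with (fun j => plus (sum_n (t j) N) (t j (S N))).
    + intros j; now rewrite sum_Sn.
    + now apply (is_series_plus (V := R_NormedModule)).
Qed.

Definition window (p k n : nat) : R :=
  if ((p <=? n) && (n <=? k))%nat%bool then 1 else 0.

Lemma window_in (p k n : nat) : (p <= n <= k)%nat -> window p k n = 1.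
Proof.
  intros [Hp Hk]; unfold window.
  apply Nat.leb_le in Hp, Hk; now rewrite Hp, Hk.
Qed.

Lemma window_out (p k n : nat) : ~ (p <= n <= k)%nat -> window p k n = 0.
Proof.
  intros Hn; unfold window.
  destruct (Nat.leb_spec p n), (Nat.leb_spec n k); tauto || lia.
Qed.

Lemma window_bounds (p k n : nat) : 0 <= window p k n <= 1.
Proof. unfold window; destruct (_ && _)%bool; lra. Qed.

Lemma sum_n_window_le (v : nat -> R) (p k N : nat) :
  (forall n, 0 <= v n) ->
  sum_n (fun n => window p k n * v n) N <= sum_n_m v p k.
Proof.
  intros Hv.
  assert (Hpos : forall n m, 0 <= sum_n_m v n m)
    by (intros n m; now apply sum_n_m_ge_0).
  (* The left-hand side is the sum of [v] over the part of the window up to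
     [N]. *)
  apply Rle_trans with (sum_n_m v p (Nat.min N k)).
  - induction N as [|N IH]; [rewrite sum_O|rewrite sum_Sn].
    + destruct (Nat.le_gt_cases p 0) as [Hp|Hp].
      * replace p with 0%nat by lia.
        rewrite window_in, Rmult_1_l, sum_n_n by lia; apply Rle_refl.
      * rewrite window_out, Rmult_0_l by lia; apply Hpos.
    + change (@plus R_AbelianMonoid) with Rplus.
      destruct (Nat.le_gt_cases (S N) k) as [Hk|Hk].
      * rewrite !Nat.min_l in * by lia.
        destruct (Nat.le_gt_cases p (S N)) as [Hp|Hp].
        -- rewrite sum_n_Sm, window_in by easy; unfold plus; simpl; lra.
        -- rewrite (sum_n_m_zero v p) in * by lia.
           rewrite window_out by lia; unfold zero in *; simpl in *; lra.
      * rewrite Nat.min_r in * by lia.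
        rewrite window_out by lia; lra.
  - destruct (Nat.le_gt_cases N k) as [HN|HN].
    + rewrite Nat.min_l by easy.
      destruct (Nat.le_gt_cases p (S N)) as [Hp|Hp].
      * rewrite (sum_n_m_Chasles v p N k) by lia.
        specialize (Hpos (S N) k); unfold plus; simpl; lra.
      * rewrite (sum_n_m_zero v p) by lia; apply Hpos.
    + rewrite Nat.min_r by lia; apply Rle_refl.
Qed.

(** The sequence is [a n = sqrt (sum_j (b_j n)^2)], where [b_j] equals
    [(2^j / S_j) v] on the [j]-th chosen window [W_j] and 0 elsewhere, so that
    [a >= b_j] for every [j].  The sum of [b_j] over [W_j] is [2^j], and that of
    [b_j^2 / v] is [4^j / S_j], which is summable in [j] because [S_j > 8^j].
    Below, [t j n] is [(b_j n / v n)^2]. *)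
Lemma exists_sequence_unbounded_on_windows (v : nat -> R) (p k : nat -> nat) :
  (forall n, 0 < v n) ->
  (forall A, exists i, A < sum_n_m v (p i) (k i)) ->
  exists a : nat -> R,
    (forall n, 0 <= a n) /\ ex_series (fun n => a n ^ 2 / v n) /\
    (forall A, exists i, A < sum_n_m a (p i) (k i)).
Proof.
  intros Hv Hunb.
  assert (Hv0 : forall n, 0 <= v n) by (intros n; now apply Rlt_le).
  destruct (functional_choice (fun j i => 8 ^ j < sum_n_m v (p i) (k i))
              (fun j => Hunb (8 ^ j))) as [i Hi].
  pose (S := (fun j => sum_n_m v (p (i j)) (k (i j))) : nat -> R).
  set (chi j := window (p (i j)) (k (i j))).
  set (t j n := (2 ^ j / S j) ^ 2 * chi j n).
  assert (HS : forall j, 8 ^ j < S j) by apply Hi.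
  assert (H2 : forall j, 1 <= 2 ^ j) by (intros j; apply pow_R1_Rle; lra).
  assert (H8 : forall j, 8 ^ j = 2 ^ j * 2 ^ j * 2 ^ j).
  { intros j; rewrite <- !Rpow_mult_distr; f_equal; ring. }
  assert (HSpos : forall j, 0 < S j).
  { intros j; apply Rlt_trans with (2 := HS j), pow_lt; lra. }
  assert (Ht0 : forall j n, 0 <= t j n).
  { intros j n; apply Rmult_le_pos; [apply pow2_ge_0|apply window_bounds]. }
  assert (Hgeom : ex_series (fun j => (/ 2) ^ j)).
  { exists (/ (1 - / 2)); apply is_series_geom.
    rewrite Rabs_pos_eq; lra. }
  assert (HtS : forall j, (2 ^ j / S j) ^ 2 * S j <= (/ 2) ^ j).
  { intros j; rewrite pow_inv.
    replace ((2 ^ j / S j) ^ 2 * S j) with (2 ^ j * 2 ^ j / S j)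
      by (field; specialize (HSpos j); lra).
    apply Rle_div_l; [apply HSpos|].
    specialize (HS j); rewrite H8 in HS; specialize (H2 j).
    apply Rmult_le_reg_l with (2 ^ j); [lra|].
    replace (2 ^ j * (/ 2 ^ j * S j)) with (S j) by (field; lra); lra. }
  assert (Hsum : forall j N, sum_n (fun n => v n * t j n) N <= (/ 2) ^ j).
  { intros j N; apply Rle_trans with (2 := HtS j).
    rewrite (sum_n_ext _ (fun n => (2 ^ j / S j) ^ 2 * (chi j n * v n)))
      by (intros n; simpl; unfold t; ring).
    rewrite (sum_n_mult_l (K := R_Ring)).
    apply Rmult_le_compat_l; [apply pow2_ge_0|].
    now apply sum_n_window_le. }
  assert (Hex : forall n, ex_series (fun j => t j n)).
  { intros n; apply (ex_series_le (V := R_CompleteNormedModule)) with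
      (fun j => / v n * (/ 2) ^ j).
    - intros j; change (Rabs (t j n) <= / v n * (/ 2) ^ j).
      rewrite Rabs_pos_eq by apply Ht0.
      apply Rmult_le_reg_l with (v n); auto.
      rewrite <- Rmult_assoc, Rinv_r, Rmult_1_l by (apply Rgt_not_eq, Hv).
      apply Rle_trans with (2 := Hsum j n).
      destruct n as [|n]; [rewrite sum_O; apply Rle_refl|].
      rewrite sum_Sn.
      assert (0 <= sum_n (fun n => v n * t j n) n)
        by (apply sum_n_m_ge_0; intros l; now apply Rmult_le_pos).
      unfold plus; simpl; lra.
    - apply (ex_series_scal (V := R_NormedModule)), Hgeom. }
  assert (Hs0 : forall n, 0 <= Series (fun j => t j n)).
  { intros n; apply Rle_trans with (t 0%nat n); [apply Ht0|].
    apply (Series_ge_term (fun j => t j n)); auto. }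
  exists (fun n => v n * sqrt (Series (fun j => t j n))); repeat split.
  - intros n; apply Rmult_le_pos; auto; apply sqrt_pos.
  - apply ex_series_ext with (fun n => v n * Series (fun j => t j n)).
    { intros n; change (@eq R (v n * Series (fun j => t j n))
        ((v n * sqrt (Series (fun j => t j n))) ^ 2 / v n)).
      rewrite Rpow_mult_distr, pow2_sqrt by auto.
      field; apply Rgt_not_eq, Hv. }
    apply ex_series_bounded with (Series (fun j => (/ 2) ^ j)).
    + intros n; now apply Rmult_le_pos.
    + intros N.
      rewrite <- (is_series_unique _ _ (is_series_sum_n
        (fun j n => v n * t j n) (fun n => v n * Series (fun j => t j n)) N
        (fun n => is_series_scal_l (v n) _ _ (Series_correct _ (Hex n))))).
      apply Series_le; auto.
      intros j; split; [|apply Hsum].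
      apply sum_n_m_ge_0; intros l; now apply Rmult_le_pos.
  - intros A.
    destruct (Pow_x_infinity 2 ltac:(rewrite Rabs_pos_eq; lra) (A + 1))
      as [j Hj].
    specialize (Hj j (Nat.le_refl j)).
    rewrite Rabs_pos_eq in Hj by (specialize (H2 j); lra).
    exists (i j); apply Rlt_le_trans with (2 ^ j); [lra|].
    apply Rle_trans with
      (sum_n_m (fun n => 2 ^ j / S j * (chi j n * v n)) (p (i j)) (k (i j))).
    + rewrite (sum_n_m_mult_l (K := R_Ring)).
      rewrite (sum_n_m_ext_loc _ v).
      * fold (S j); apply Req_le; unfold mult; simpl; field.
        apply Rgt_not_eq, HSpos.
      * intros n Hn; unfold chi; rewrite window_in by easy.
        apply Rmult_1_l.
    + apply sum_n_m_le; intros n.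
      assert (Hd : 0 <= 2 ^ j / S j).
      { apply Rlt_le, Rdiv_lt_0_compat; [specialize (H2 j); lra|auto]. }
      assert (Hle : 2 ^ j / S j * chi j n <= sqrt (Series (fun j => t j n))).
      { assert (Hc := window_bounds (p (i j)) (k (i j)) n); fold (chi j) in Hc.
        rewrite <- (sqrt_pow2 (2 ^ j / S j * chi j n))
          by (apply Rmult_le_pos; tauto).
        apply sqrt_le_1_alt, Rle_trans with (t j n).
        - unfold t; rewrite Rpow_mult_distr.
          apply Rmult_le_compat_l; [apply pow2_ge_0|nra].
        - apply (Series_ge_term (fun j => t j n)); auto. }
      specialize (Hv0 n); nra.
Qed.

(** * The theorem *)

Theorem theorem1p4 (r w : nat -> R)
  (r_incr : Un_growing r)
  (r_bound : forall k : nat, 0 < r k < powerRZ 2 (Z.of_nat k - 10))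
  (w_pos : forall k : nat, 0 < w k)
  (sup_infinite :
     Sup_seq (fun k : nat =>
       Finite (sum_Z (inv_sq_weight w) (Zfloor (log2 (r k))) (Z.of_nat k)))
     = p_infty) :
  exists a : nat -> C,
    ex_series (fun k : nat => (Cmod (a k)) ^ 2 * (w k) ^ 2) /\
    ~ (exists f : R -> C,
         continuous_on_circle f /\
         (forall k : nat,
            Cmod (fourier_coeff f (2 ^ Z.of_nat k)) >= Cmod (a k)) /\
         (forall n : Z,
            ~ (exists k : nat, 2 ^ k - r k <= IZR n <= 2 ^ k + r k) ->
            fourier_coeff f n = RtoC 0)).
Proof.
  assert (Hr4 : forall l, r l <= 2 ^ l / 4).
  { intros l; destruct (r_bound l) as [_ H].
    unfold Zminus in H; rewrite powerRZ_add, <- pow_powerRZ in H by lra.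
    simpl powerRZ in H.
    assert (0 < 2 ^ l) by (apply pow_lt; lra).
    lra. }
  set (p k := Z.to_nat (Zfloor (log2 (r k)))).
  assert (Hfloor : forall k, (Zfloor (log2 (r k)) <= Z.of_nat k)%Z).
  { intros k; apply Zfloor_log2_le; [apply r_bound|].
    apply Rle_trans with (1 := Hr4 k).
    assert (0 < 2 ^ k) by (apply pow_lt; lra); lra. }
  destruct (exists_sequence_unbounded_on_windows
              (fun n => / (w n) ^ 2) p (fun k => k)) as [a [Ha [Hser Hunb]]].
  - intros n; now apply Rinv_0_lt_compat, pow_lt.
  - intros A.
    assert (HA : Rbar_lt A p_infty) by exact I.
    rewrite <- sup_infinite in HA.
    apply Sup_seq_minor_lt in HA; destruct HA as [k Hk].
    simpl in Hk; rewrite sum_Z_inv_sq_weight in Hk by auto.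
    now exists k.
  - exists (fun n => RtoC (a n)); split.
    + revert Hser; apply ex_series_ext; intros n.
      rewrite Cmod_R, Rabs_pos_eq by auto.
      unfold Rdiv; now rewrite Rinv_inv.
    + intros [f [[Hf _] [Hfa Hspec]]].
      destruct (Ccontinuous_bounded f (- (1 / 2)) (1 / 2)) as [M HM];
        [lra|exact Hf|].
      destruct (Hunb (5 * M)) as [k Hk].
      apply (Rlt_not_le _ _ Hk).
      apply Rle_trans with
        (sum_n_m (fun n => Cmod (fourier_coeff f (2 ^ Z.of_nat n))) (p k) k).
      * apply sum_n_m_le; intros n.
        specialize (Hfa n); rewrite Cmod_R, Rabs_pos_eq in Hfa by auto; lra.
      * apply window_sum_le with r; auto.
        -- unfold p; specialize (Hfloor k); lia.
        -- apply lt_pow2_Zfloor_log2, r_bound.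
Qed.
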